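(* The unimodular simply connected Lie group $S_9^{-1}$ has lattices.
   Context: A lattice in a simply connected solvable Lie group $G$ is a discrete subgroup $\Gamma$ with $\Gamma\backslash G$ compact. $S_9^{-1}$ is the simply connected Lie group $\mathbb{R}\times\mathbb{R}^{11}$ with product $(t,v)(s,w)=(t+s,v+e^{tA}w)$, where $A=0_3\oplus I_4\oplus(-I_4)$ (block diagonal sum). *)

(* Defs.v *)
From HB Require Import structures.
From mathcomp Require Import all_boot all_order all_algebra.
From mathcomp Require Import all_classical all_reals all_analysis.

Set Implicit Arguments.
Unset Strict Implicit.
Unset Printing Implicit Defensive.

Import Order.TTheory GRing.Theory Num.Theory.
Import numFieldNormedType.Exports.

Local Open Scope classical_set_scope.
Local Open Scope ring_scope.
Local Open Scope quotient_scope.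

HB.mixin Record Group_isTopologicalGroup G & Topological G & Group G := {
  mulg_continuous : continuous (fun p : G * G => (p.1 * p.2)%g) ;
  invg_continuous : continuous (fun x : G => (x^-1)%g)
}.

#[short(type="topologicalGroupType")]
HB.structure Definition TopologicalGroup :=
  {G of Topological G & Group G & Group_isTopologicalGroup G}.

Section Lattices.
Variable G : topologicalGroupType.

Section CosetSpace.
Variable H : groupClosed G.

(* [x y^-1 \in H] iff [H x = H y]: the classes are the orbits of the left
   translation action of [H] on [G]. *)
Definition same_rcoset (x y : G) : bool := (x / y)%g \in H.

Lemma same_rcoset_refl : reflexive same_rcoset.
Proof. by move=> x; rewrite /same_rcoset mulgV gpred1. Qed.

Lemma same_rcoset_sym : symmetric same_rcoset.
Proof. by move=> x y; rewrite /same_rcoset gpredFC. Qed.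

Lemma same_rcoset_trans : transitive same_rcoset.
Proof.
move=> y x z xy yz; rewrite /same_rcoset.
have -> : (x / z = (x / y) * (y / z))%g by rewrite mulgA mulgVK.
exact: gpredM.
Qed.

Canonical same_rcoset_equiv :=
  EquivRel same_rcoset same_rcoset_refl same_rcoset_sym same_rcoset_trans.

(* The space [H \ G] with the quotient topology. *)
Definition coset_space : topologicalType :=
  quotient_topology {eq_quot same_rcoset_equiv}.

End CosetSpace.

Definition is_lattice (H : groupClosed G) : Prop :=
  [set` H] `<=` isolated [set` H] /\ compact [set: coset_space H].

Definition has_lattice : Prop := exists H : groupClosed G, is_lattice H.

End Lattices.

Section MatrixExponential.
Variables (R : realType) (n : nat).

Definition expmx (M : 'M[R]_n.+1) : 'M[R]_n.+1 :=
  limn (series (fun k => k`!%:R^-1 *: M ^+ k)).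

Lemma cvg_mx (u : nat -> 'M[R]_n.+1) (M : 'M[R]_n.+1) :
  (forall i j, (fun k => u k i j) @ \oo --> M i j) -> u @ \oo --> M.
Proof.
move=> uM A [P MP sPA].
have : \forall k \near \oo, forall ij : 'I_n.+1 * 'I_n.+1,
    P ij.1 ij.2 (u k ij.1 ij.2).
  by apply: filter_forall => -[i j]; apply: (uM i j); exact: MP.
by apply: filterS => k Pk; apply: sPA => i j; exact: (Pk (i, j)).
Qed.

Lemma exprmx_diag (d : 'rV[R]_n.+1) k :
  diag_mx d ^+ k = diag_mx (\row_i d 0 i ^+ k).
Proof.
elim: k => [|k IHk].
  by rewrite expr0; apply/matrixP => i j; rewrite !mxE expr0.
rewrite exprS IHk -mulmxE mulmx_diag; congr diag_mx.
by apply/rowP => i; rewrite !mxE exprS.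
Qed.

Lemma expmx_diag (d : 'rV[R]_n.+1) :
  expmx (diag_mx d) = diag_mx (\row_i expR (d 0 i)).
Proof.
apply: cvg_lim; first exact: norm_hausdorff.
apply: cvg_mx => i j; rewrite !mxE.
have -> : (fun k => series (fun k => k`!%:R^-1 *: diag_mx d ^+ k) k i j) =
    (fun k => series (exp_coeff (d 0 i)) k *+ (i == j)).
  apply/funext => k; rewrite /series /= summxE -sumrMnl.
  by apply: eq_bigr => l _; rewrite exprmx_diag !mxE mulrnAr mulrC.
case: (i == j) => /=; last exact: cvg_cst.
exact: is_cvg_series_exp_coeff.
Qed.

End MatrixExponential.

Section S9.
Variable R : realType.

Definition S9_mx : 'M[R]_(3 + (4 + 4)) :=
  block_mx (0 : 'M[R]_3) 0 0 (block_mx (1%:M : 'M[R]_4) 0 0 (- (1%:M : 'M[R]_4))).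

Definition S9_exp (t : R) : 'M[R]_11 := expmx (t *: (S9_mx : 'M[R]_11)).

Definition S9_diag : 'rV[R]_(3 + (4 + 4)) :=
  row_mx (0 : 'rV[R]_3) (row_mx (const_mx 1 : 'rV[R]_4) (const_mx (-1) : 'rV[R]_4)).

Lemma S9_mxE : S9_mx = diag_mx S9_diag.
Proof.
rewrite /S9_mx /S9_diag !diag_mx_row.
have -> : diag_mx (0 : 'rV[R]_3) = 0.
  by apply/matrixP => i j; rewrite !mxE mul0rn.
rewrite diag_const_mx; do 2!congr block_mx.
by apply/matrixP => i j; rewrite !mxE mulNrn.
Qed.

Lemma S9_expE t : S9_exp t = diag_mx (\row_i expR (t * S9_diag 0 i)).
Proof.
rewrite /S9_exp S9_mxE.
have -> : t *: (diag_mx S9_diag : 'M[R]_11) = diag_mx (t *: S9_diag : 'rV[R]_11).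
  by apply/matrixP => i j; rewrite !mxE mulrnAr.
by rewrite expmx_diag; congr diag_mx; apply/rowP => i; rewrite !mxE.
Qed.

Lemma S9_exp0 : S9_exp 0 = 1%:M.
Proof.
rewrite S9_expE; apply/matrixP => i j.
by rewrite !mxE mul0r expR0.
Qed.

Lemma S9_expD s t : S9_exp (s + t) = S9_exp s *m S9_exp t.
Proof.
rewrite !S9_expE mulmx_diag; congr diag_mx; apply/rowP => i.
by rewrite !mxE mulrDl expRD.
Qed.

(* The group [S_9^{-1}]: the semidirect product of [R] and [R^11] in which [t]
   acts on [R^11] by [exp (t A)]. *)
Definition S9 : Type := (R * 'cV[R]_11)%type.

HB.instance Definition _ := Topological.copy S9 (R * 'cV[R]_11)%type.

Definition S9_one : S9 := (0, 0).
Definition S9_mul (x y : S9) : S9 :=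
  (x.1 + y.1, x.2 + S9_exp x.1 *m y.2).
Definition S9_inv (x : S9) : S9 := (- x.1, - (S9_exp (- x.1) *m x.2)).

Lemma S9_mulA : associative S9_mul.
Proof.
move=> x y z; rewrite /S9_mul /= addrA; congr pair.
by rewrite S9_expD mulmxDr mulmxA addrA.
Qed.

Lemma S9_mul1 : left_id S9_one S9_mul.
Proof. by case=> t v; rewrite /S9_mul /= !add0r S9_exp0 mul1mx. Qed.

Lemma S9_mulr1 : right_id S9_one S9_mul.
Proof. by case=> t v; rewrite /S9_mul /= mulmx0 !addr0. Qed.

Lemma S9_mulV : left_inverse S9_one S9_inv S9_mul.
Proof. by case=> t v; rewrite /S9_mul /= !addNr. Qed.

Lemma S9_mulrV : right_inverse S9_one S9_inv S9_mul.
Proof.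
case=> t v; rewrite /S9_mul /= subrr mulmxN mulmxA -S9_expD subrr S9_exp0.
by rewrite mul1mx subrr.
Qed.

HB.instance Definition _ :=
  isGroup.Build S9 S9_mulA S9_mul1 S9_mulr1 S9_mulV S9_mulrV.

Lemma continuous_cV (T : topologicalType) (f : T -> 'cV[R]_11) (x : T) :
  (forall i, {for x, continuous (fun y => f y i 0)}) -> {for x, continuous f}.
Proof.
move=> fx A [P MP sPA].
have : \forall y \near x, forall i : 'I_11, P i 0 (f y i 0).
  by apply: filter_forall => i; apply: (fx i); exact: MP.
by apply: filterS => y Py; apply: sPA => i j; rewrite ord1.
Qed.

Lemma S9_exp_mulE t (v : 'cV[R]_11) i :
  (S9_exp t *m v) i 0 = expR (t * S9_diag 0 i) * v i 0.
Proof. by rewrite S9_expE mul_diag_mx !mxE. Qed.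

Lemma S9_exp_mul_continuous (T : topologicalType) (f : T -> R)
    (g : T -> 'cV[R]_11) : continuous f -> continuous g ->
  continuous (fun x => S9_exp (f x) *m g x).
Proof.
move=> cf cg x; apply: continuous_cV => i.
have -> : (fun y => (S9_exp (f y) *m g y) i 0) =
    (fun y => expR (f y * S9_diag 0 i) * g y i 0).
  by apply/funext => y; exact: S9_exp_mulE.
apply: (@continuousM _ _ (fun y => expR (f y * S9_diag 0 i)) (fun y => g y i 0)).
  apply: (@continuous_comp _ _ _ (fun y => f y * S9_diag 0 i) expR).
    by apply: continuousM; [exact: cf|exact: cvg_cst].
  exact: continuous_expR.
apply: (@continuous_comp _ _ _ g (fun v : 'cV[R]_11 => v i 0)); first exact: cg.
exact: coord_continuous.
Qed.

Lemma S9_pair_continuous (T : topologicalType) (f : T -> R)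
    (g : T -> 'cV[R]_11) : continuous f -> continuous g ->
  continuous (fun x => (f x, g x) : S9).
Proof. by move=> cf cg x; exact: (cvg_pair (cf x) (cg x)). Qed.

Lemma S9_mul_continuous : continuous (fun p : S9 * S9 => (p.1 * p.2)%g).
Proof.
have c1 : continuous (fun p : S9 * S9 => p.1 : R * 'cV[R]_11).
  by move=> p; exact: cvg_fst.
have c2 : continuous (fun p : S9 * S9 => p.2 : R * 'cV[R]_11).
  by move=> p; exact: cvg_snd.
have cf : continuous (fun p : S9 * S9 => p.1.1).
  by move=> p; apply: (continuous_comp (c1 p)); exact: cvg_fst.
have cg : continuous (fun p : S9 * S9 => p.2.1).
  by move=> p; apply: (continuous_comp (c2 p)); exact: cvg_fst.
have cv : continuous (fun p : S9 * S9 => p.1.2).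
  by move=> p; apply: (continuous_comp (c1 p)); exact: cvg_snd.
have cw : continuous (fun p : S9 * S9 => p.2.2).
  by move=> p; apply: (continuous_comp (c2 p)); exact: cvg_snd.
apply: (@S9_pair_continuous _ (fun p : S9 * S9 => p.1.1 + p.2.1)
  (fun p => p.1.2 + S9_exp p.1.1 *m p.2.2)) => p.
  by apply: cvgD; [exact: cf|exact: cg].
by apply: cvgD; [exact: cv|exact: (S9_exp_mul_continuous cf cw)].
Qed.

Lemma S9_inv_continuous : continuous (fun x : S9 => (x^-1)%g).
Proof.
have cf : continuous (fun p : S9 => - p.1).
  by move=> p; apply: cvgN; exact: cvg_fst.
have cv : continuous (fun p : S9 => p.2) by move=> p; exact: cvg_snd.
apply: (@S9_pair_continuous _ (fun p : S9 => - p.1)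
  (fun p => - (S9_exp (- p.1) *m p.2))) => p; first exact: cf.
by apply: cvgN; exact: (S9_exp_mul_continuous cf cv).
Qed.

HB.instance Definition _ :=
  Group_isTopologicalGroup.Build S9 S9_mul_continuous S9_inv_continuous.

End S9.

(* Main.v *)
(* Take l = (3 + sqrt 5) / 2 and m = l^-1, the roots of X^2 - 3 X + 1, and
   t0 = ln l. On each plane spanned by the basis vectors 3 + j and 7 + j,
   e^(t0 A) is diag (l, m); in the basis (1, 1), (l, m) of that plane its matrix
   is the companion matrix [[0, -1], [1, 3]] of X^2 - 3 X + 1, which lies in
   SL_2(Z). So e^(t0 A) preserves the lattice L of R^11 spanned by these vectors
   together with the first three basis vectors, and the semidirect product of
   t0 Z and L is a lattice of the group: it is discrete, and every coset meets
   the compact image of the unit cube [0, 1] x [0, 1]^11. *)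
Require Import Defs.
From HB Require Import structures.
From mathcomp Require Import all_boot all_order all_algebra.
From mathcomp Require Import all_classical all_reals all_analysis.
From mathcomp Require Import ring lra.

Set Implicit Arguments.
Unset Strict Implicit.
Unset Printing Implicit Defensive.

Import Order.TTheory GRing.Theory Num.Theory.
Import numFieldNormedType.Exports.

Local Open Scope classical_set_scope.
Local Open Scope ring_scope.
Local Open Scope quotient_scope.

(** * Integral matrices, continuity of linear maps and compactness of the cube *)

Lemma int_num_lt1_eq0 (R : archiRealDomainType) (x : R) :
  x \is a Num.int -> `|x| < 1 -> x = 0.
Proof.
by move=> /norm_intr_ge1 xge1 xlt1; apply: contraTeq xlt1; rewrite -leNgt.
Qed.

Lemma mxOver_intD (R : archiNumDomainType) p q (A B : 'M[R]_(p, q)) :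
  A \is a mxOver Num.int -> B \is a mxOver Num.int ->
  A + B \is a mxOver Num.int.
Proof.
by move=> /mxOverP Aint /mxOverP Bint; apply/mxOverP => i j; rewrite mxE rpredD.
Qed.

Lemma mxOver_intN (R : archiNumDomainType) p q (A : 'M[R]_(p, q)) :
  A \is a mxOver Num.int -> - A \is a mxOver Num.int.
Proof.
by move=> /mxOverP Aint; apply/mxOverP => i j; rewrite mxE rpredN.
Qed.

Lemma mxOver_block (T : Type) (S : {pred T}) p1 p2 q1 q2
    (A : 'M[T]_(p1, q1)) (B : 'M[T]_(p1, q2))
    (C : 'M[T]_(p2, q1)) (D : 'M[T]_(p2, q2)) :
  A \is a mxOver S -> B \is a mxOver S -> C \is a mxOver S ->
  D \is a mxOver S -> block_mx A B C D \is a mxOver S.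
Proof.
move=> /mxOverP AS /mxOverP BS /mxOverP CS /mxOverP DS.
by apply/mxOverP => i j; rewrite mxE; case: fintype.split => k;
  rewrite mxE; case: fintype.split.
Qed.

Lemma mulmx_continuous (R : realType) (A : 'M[R]_11) :
  continuous (mulmx A : 'cV[R]_11 -> 'cV[R]_11).
Proof.
move=> v; apply: continuous_cV => i.
have -> : (fun w : 'cV[R]_11 => (A *m w) i 0) =
    (fun w => \sum_j A i j * w j 0) by apply/funext => w; rewrite mxE.
apply: (@cvg_big _ _ _ _ _ _ _ (nbhs v)) => [|j _].
  exact: add_continuous.
by apply: cvgMr; exact: coord_continuous.
Qed.

Lemma compact_cube (R : realType) (n : nat) :
  compact [set v : 'rV[R]_n | forall i, v ord0 i \in `[0, 1]].
Proof.
apply: (@rV_compact _ _ (fun=> `[(0 : R), 1]%classic)) => i.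
exact: segment_compact.
Qed.

(** The unit cube is taken among row vectors, the group among columns; transposition passes from one
    to the other. *)
Lemma trmx_col_continuous (R : realType) :
  continuous (@trmx R 1 11).
Proof.
move=> v; apply: continuous_cV => i.
have -> : (fun w : 'rV[R]_11 => w^T i 0) = (fun w => w 0 i).
  by apply/funext => w; rewrite mxE.
exact: coord_continuous.
Qed.

(** * Lattices from a basis in which e^(t0 A) and its inverse are integral *)

Section IntegralBasis.
Variables (R : realType) (t0 : R) (P Q B C : 'M[R]_11).
Hypotheses (t0_gt0 : 0 < t0) (PQ : P *m Q = 1%:M)
  (PB : S9_exp t0 *m P = P *m B) (PC : S9_exp (- t0) *m P = P *m C)
  (Bint : B \is a mxOver Num.int) (Cint : C \is a mxOver Num.int).

Let QP : Q *m P = 1%:M := mulmx1C PQ.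

(** The matrix of e^(s A) in the basis formed by the columns of [P]. *)
Let M (s : R) := Q *m S9_exp s *m P.

Let M_D s t : M (s + t) = M s *m M t.
Proof. by rewrite /M S9_expD -!mulmxA (mulmxA P) PQ mul1mx !mulmxA. Qed.

Let M_t0 : M t0 = B.
Proof. by rewrite /M -mulmxA PB mulmxA QP mul1mx. Qed.

Let M_Nt0 : M (- t0) = C.
Proof. by rewrite /M -mulmxA PC mulmxA QP mul1mx. Qed.

(** Since [M] turns sums into products, [M s] is a power of [B] or of [C], according to the sign of
    the integer [s / t0]. *)
Lemma S9_exp_conj_int (s : R) :
  s / t0 \is a Num.int -> M s \is a mxOver Num.int.
Proof.
move=> /intrP[z sz]; have {sz}-> : s = z%:~R * t0.
  by rewrite -sz divfK ?gt_eqF.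
elim/int_rect: z => [|n IH|n IH].
- rewrite mul0r /M S9_exp0 mulmx1 QP.
  by apply: mxOver_scalar; [exact: int_num0|exact: int_num1].
- have -> : n.+1%:Z%:~R * t0 = n%:Z%:~R * t0 + t0.
    by rewrite -addn1 PoszD intrD mulrDl mul1r.
  by rewrite M_D M_t0; exact: mxOverM IH Bint.
- have -> : (- n.+1%:Z)%:~R * t0 = (- n%:Z)%:~R * t0 - t0.
    by rewrite -addn1 PoszD opprD intrD mulrDl mulrN1z mulN1r.
  by rewrite M_D M_Nt0; exact: mxOverM IH Cint.
Qed.

(** The semidirect product of t0 Z and P Z^11; [Q *m x.2] gives the coordinates of [x.2] in the
    basis. *)
Definition S9_int_pts : {pred S9 R} := fun x =>
  (x.1 / t0 \is a Num.int) && (Q *m x.2 \is a mxOver Num.int).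

Let act_int (s : R) (v : 'cV[R]_11) : s / t0 \is a Num.int ->
  Q *m v \is a mxOver Num.int -> Q *m (S9_exp s *m v) \is a mxOver Num.int.
Proof.
move=> sint vint; have -> : Q *m (S9_exp s *m v) = M s *m (Q *m v).
  by rewrite /M -!mulmxA (mulmxA P) PQ mul1mx.
exact: (mxOverM (S9_exp_conj_int sint) vint).
Qed.

Lemma S9_int_pts1 : (1%g : S9 R) \in S9_int_pts.
Proof.
apply/andP; split; first by rewrite mul0r int_num0.
by rewrite mulmx0 mxOver0 ?int_num0.
Qed.

Lemma S9_int_ptsM : mulg_closed S9_int_pts.
Proof.
move=> x y /andP[x1 x2] /andP[y1 y2]; apply/andP; split.
  by rewrite mulrDl rpredD.
rewrite mulmxDr.
exact: mxOver_intD x2 (act_int x1 y2).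
Qed.

Lemma S9_int_ptsV : invg_closed S9_int_pts.
Proof.
move=> x /andP[x1 x2]; have xN : - x.1 / t0 \is a Num.int by rewrite mulNr rpredN.
apply/andP; split => //=; rewrite mulmxN.
exact: mxOver_intN (act_int xN x2).
Qed.

Definition S9_int_group : groupClosed (S9 R) :=
  HB.pack S9_int_pts (isInvClosed.Build _ _ S9_int_ptsV)
    (isMul1Closed.Build _ _ S9_int_pts1) (isMulClosed.Build _ _ S9_int_ptsM).

(** Points of the group have integral coordinates, so two of them whose coordinates all differ by
    less than 1 coincide. *)
Lemma S9_int_group_discrete :
  [set` S9_int_group] `<=` isolated [set` S9_int_group].
Proof.
move=> x xG; split; first by rewrite inE.
exists [set y : S9 R | `|x.1 / t0 - y.1 / t0| < 1 /\
    forall i, `|(Q *m x.2) i 0 - (Q *m y.2) i 0| < 1].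
  apply: filterI.
    have c : (y.1 / t0 @[y --> x]) --> x.1 / t0 by apply: cvgMl; exact: cvg_fst.
    exact: cvgr_dist_lt c _ ltr01.
  suff : \forall y \near x, forall i, `|(Q *m x.2) i 0 - (Q *m y.2) i 0| < 1.
    by [].
  apply (@filter_forall _ _ _ _ (nbhs_filter x)) => i.
  have c : ((Q *m y.2) i 0 @[y --> x]) --> (Q *m x.2) i 0.
    apply: (@continuous_comp _ _ _ (fun y : S9 R => Q *m y.2)
      (fun v : 'cV[R]_11 => v i 0)); last exact: coord_continuous.
    apply: (@continuous_comp _ _ _ (fun y : S9 R => y.2) (mulmx Q)).
      exact: cvg_snd.
    exact: mulmx_continuous.
  exact: cvgr_dist_lt c _ ltr01.
apply/seteqP; split=> [y [[yx1 yx2]]|_ ->] /=; last first.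
  by split=> //; rewrite subrr normr0; split=> // i; rewrite subrr normr0.
move=> yG; move: xG yG => /andP[x1 x2] /andP[y1 y2].
have /mulIf xy1 : t0^-1 != 0 by rewrite invr_eq0 gt_eqF.
have e1 : x.1 = y.1.
  by apply: xy1; apply/subr0_eq/int_num_lt1_eq0; rewrite ?rpredB.
have e2 : x.2 = y.2.
  rewrite -[x.2]mul1mx -[y.2]mul1mx -PQ -!mulmxA; congr mulmx.
  apply/colP => i; apply/subr0_eq/int_num_lt1_eq0 => //.
  by rewrite rpredB// (mxOverP _).
by apply/esym; rewrite [x]surjective_pairing e1 e2 -surjective_pairing.
Qed.

Lemma S9_int_group_cocompact : compact [set: coset_space S9_int_group].
Proof.
pose K := [set u : R | u \in `[0, 1]] `*`
  [set v : 'rV[R]_11 | forall i, v ord0 i \in `[0, 1]].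
pose f (u : R * 'rV[R]_11) : S9 R := (u.1 * t0, P *m u.2^T).
have -> : [set: coset_space S9_int_group] =
    (\pi_(coset_space S9_int_group) \o f) @` K.
  apply/seteqP; split=> // q _.
  rewrite -[q]reprK; set x : S9 R := repr q.
  (* The first coordinate is reduced first: left translation by [(- s, 0)] also applies e^(-s A) to
     [x.2], so the floors [l] are those of the coordinates [w] of the transformed vector. *)
  pose n := Num.floor (x.1 / t0).
  pose s := n%:~R * t0.
  have [w wE] : exists w, P *m w = S9_exp (- s) *m x.2.
    by exists (Q *m (S9_exp (- s) *m x.2)); rewrite mulmxA PQ mul1mx.
  pose l : 'cV[R]_11 := \col_i (Num.floor (w i 0))%:~R.
  exists (x.1 / t0 - n%:~R, (w - l)^T).
    split=> [|i] /=; rewrite ?mxE.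
      by have := floor_itv (x.1 / t0); rewrite in_itv /= rmorphD /= -/n; lra.
    rewrite in_itv /=.
    by have := floor_itv (w i 0); rewrite rmorphD /=; lra.
  have fE : f (x.1 / t0 - n%:~R, (w - l)^T) =
      (((- s, - (P *m l)) : S9 R) * x)%g.
    congr pair => /=; first by rewrite mulrBl divfK ?gt_eqF // addrC.
    by rewrite trmxK mulmxBr wE addrC.
  (* It remains to see that the translating element [(- s, - (P *m l))] is integral. *)
  apply/eqmodP; rewrite fE /= /same_rcoset mulgK; apply/andP; split => /=.
    by rewrite mulNr /s mulfK ?gt_eqF // rpredN intr_int.
  rewrite mulmxN mulmxA QP mul1mx; apply/mxOver_intN/mxOverP => i j.
  by rewrite mxE intr_int.
apply: continuous_compact; last first.
  by apply: compact_setX; [exact: segment_compact|exact: compact_cube].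
apply: continuous_subspaceT => u.
apply: continuous_comp; last exact: pi_continuous.
apply: S9_pair_continuous => v.
  by apply: cvgMl; exact: cvg_fst.
apply: (@continuous_comp _ _ _ (fun u : R * 'rV[R]_11 => u.2^T) (mulmx P)).
  apply: (@continuous_comp _ _ _ snd (@trmx R 1 11)); first exact: cvg_snd.
  exact: trmx_col_continuous.
exact: mulmx_continuous.
Qed.

End IntegralBasis.

(** * Block matrices acting alike on the four planes *)

Section Pairs.
Variable R : realType.

(* The matrix acting as the 2 x 2 matrix [[a, b], [c, d]] on each of the four
   planes spanned by the basis vectors 3 + j and 7 + j, and trivially on the
   first three basis vectors. *)
Definition pairs_mx (a b c d : R) : 'M[R]_11 :=
  block_mx (1%:M : 'M[R]_3) 0 0
    (block_mx (a%:M : 'M[R]_4) b%:M c%:M (d%:M : 'M[R]_4)).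

Lemma pairs_mxM a b c d a' b' c' d' :
  pairs_mx a b c d *m pairs_mx a' b' c' d' =
  pairs_mx (a * a' + b * c') (a * b' + b * d')
    (c * a' + d * c') (c * b' + d * d').
Proof.
rewrite /pairs_mx (@mulmx_block _ 3 8 3 8 3 8) (@mulmx_block _ 4 4 4 4 4 4).
by rewrite !mulmx0 !mul0mx !addr0 !add0r mulmx1 -!scalar_mxM -!raddfD.
Qed.

Lemma pairs_mx1 : pairs_mx 1 0 0 1 = 1%:M.
Proof. by rewrite /pairs_mx !raddf0 -!scalar_mx_block. Qed.

Lemma mxOver_pairs (S : subringClosed R) a b c d :
  a \in S -> b \in S -> c \in S -> d \in S -> pairs_mx a b c d \is a mxOver S.
Proof.
move=> aS bS cS dS; have S0 := rpred0 S; have S1 := rpred1 S.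
by apply: (@mxOver_block _ _ 3 8 3 8);
  [|exact: mxOver0|exact: mxOver0|apply: (@mxOver_block _ _ 4 4 4 4)];
  apply: mxOver_scalar.
Qed.

Lemma S9_exp_pairs (s : R) : S9_exp s = pairs_mx (expR s) 0 0 (expR (- s)).
Proof.
rewrite S9_expE /pairs_mx; set d := \row_i _.
have -> : d = row_mx (const_mx 1 : 'rV[R]_3)
    (row_mx (const_mx (expR s) : 'rV[R]_4) (const_mx (expR (- s)) : 'rV[R]_4)).
  apply/rowP => i; rewrite !mxE.
  case: fintype.split => j; rewrite !mxE ?mulr0 ?expR0 //.
  by case: fintype.split => k; rewrite !mxE ?mulr1 ?mulrN1.
by rewrite !raddf0 !diag_mx_row !diag_const_mx.
Qed.

End Pairs.

(** * The integral basis given by a quadratic unit *)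

Theorem proposition6p9 (R : realType) : has_lattice (S9 R).
Proof.
pose l : R := (3 + Num.sqrt 5) / 2; pose m : R := 3 - l.
have lE : l ^+ 2 = 3 * l - 1.
  have : Num.sqrt 5 ^+ 2 = 5 :> R by rewrite sqr_sqrtr.
  by rewrite /l; nra.
have l_gt1 : 1 < l by have := sqrtr_ge0 (5 : R); rewrite /l; lra.
have lm : l * m = 1 by rewrite /m; nra.
(* The determinant of [[1, l], [1, m]]; its square is the discriminant 5 of X^2 - 3 X + 1. *)
have ml : m - l != 0.
  have : (m - l) ^+ 2 = 5 by rewrite /m; nra.
  by move=> ml5; apply/eqP => ml0; move: ml5; rewrite ml0; lra.
have t0 : 0 < ln l by rewrite ln_gt0.
have el : expR (ln l) = l by rewrite lnK // posrE; lra.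
have em : expR (- ln l) = m.
  by rewrite expRN el; apply: (@mulfI _ l); rewrite ?lm ?mulfV //; lra.
pose P := pairs_mx 1 l 1 m.
pose Q := pairs_mx (m / (m - l)) (- l / (m - l)) (- (m - l)^-1) (m - l)^-1.
have PQ : P *m Q = 1%:M.
  by rewrite /P /Q pairs_mxM -pairs_mx1; congr pairs_mx; field.
have PB : S9_exp (ln l) *m P = P *m pairs_mx 0 (-1) 1 3.
  by rewrite S9_exp_pairs /P !pairs_mxM el em /m; congr pairs_mx; nra.
(* [[3, 1], [-1, 0]] is the inverse of the companion matrix, integral because the determinant is
   1. *)
have PC : S9_exp (- ln l) *m P = P *m pairs_mx 3 1 (-1) 0.
  by rewrite S9_exp_pairs /P !pairs_mxM opprK el em /m; congr pairs_mx; nra.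
have Bint : pairs_mx 0 (-1) 1 3 \is a mxOver (Num.int : {pred R}).
  by apply: mxOver_pairs; rewrite ?rpredN ?rpred0 ?rpred1 ?rpred_nat.
have Cint : pairs_mx 3 1 (-1) 0 \is a mxOver (Num.int : {pred R}).
  by apply: mxOver_pairs; rewrite ?rpredN ?rpred0 ?rpred1 ?rpred_nat.
exists (S9_int_group t0 PQ PB PC Bint Cint).
split; [exact: S9_int_group_discrete|exact: S9_int_group_cocompact].
Qed.
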